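(* Let $\phi:\mathbb{R}^n\to\mathbb{R}$ be a closed convex function with convex conjugate $\phi^*$, let $r=\frac12\|\cdot\|_2^2$ on $\mathbb{R}^d$ with conjugate $r^*$, let $A\in\mathbb{R}^{n\times d}$ and $\lambda>0$, and define, for $x\in\mathbb{R}^d$ and $y\in\mathbb{R}^n$, $$f(x):=\phi(Ax)+\lambda r(x),\qquad q(y):=\phi^*(y)+\lambda r^*\!\left(-\tfrac1\lambda A^{\top}y\right).$$ Suppose $\phi$ is $\beta$-smooth in the Euclidean norm, $\beta>0$, and that $\phi^*$ is of Legendre type. Let $L:=\lambda+\beta\|A\|_2^2$. Then $f$ is $L$-smooth and $\lambda$-strongly convex in the Euclidean norm, and the lifted problem $F(x,y):=f(x)+q(y)$ is $L$-smooth and $\lambda$-strongly convex relative to the reference function $$h(x,y):=\tfrac12\|x\|_2^2+\tfrac1\lambda\phi^*(y).$$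
   Context: $\|A\|_2$ is the spectral norm. A differentiable function is $\beta$-smooth in the Euclidean norm if its gradient is $\beta$-Lipschitz in $\|\cdot\|_2$; a function $f$ is $\lambda$-strongly convex in the Euclidean norm if $f-\frac\lambda2\|\cdot\|_2^2$ is convex. Legendre type: closed proper convex, essentially smooth (the interior of the domain is nonempty, the function is differentiable there, and the norm of its gradient tends to infinity along every sequence in the interior of the domain converging to a boundary point of the domain), and strictly convex on the interior of the domain. For a Legendre reference function $h$ with domain $\mathcal{Z}$ (here $\mathcal{Z}=\mathbb{R}^d\times\operatorname{dom}\phi^*$), the Bregman divergence is $D(w,z):=h(w)-h(z)-\langle\nabla h(z),w-z\rangle$ for $w\in\mathcal{Z}$, $z\in\operatorname{int}(\mathcal{Z})$. A convex function $F:\mathcal{Z}\to\mathbb{R}$ with subgradient selection $g(z)\in\partial F(z)$ is $L$-smooth relative to $h$ if $F(w)\le F(z)+\langle g(z),w-z\rangle+L\,D(w,z)$, and $\lambda$-strongly convex relative to $h$ if $F(w)\ge F(z)+\langle g(z),w-z\rangle+\lambda\,D(w,z)$, in both cases for all $z\in\operatorname{int}(\mathcal{Z})$, $w\in\mathcal{Z}$. *)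

(* Defs.v *)
From HB Require Import structures.
From mathcomp Require Export all_boot all_order all_algebra.
From mathcomp Require Export all_classical all_reals all_analysis.

Set Implicit Arguments.
Unset Strict Implicit.
Unset Printing Implicit Defensive.

Import Order.TTheory GRing.Theory Num.Theory.
Export numFieldNormedType.Exports.

Local Open Scope classical_set_scope.
Local Open Scope ring_scope.

(* The space R^m is 'cV[R]_m.  The library norm
   on matrices is the sup norm, so the Euclidean structure is introduced here;
   the library topology and the library notion of differentiability do not
   depend on this choice, the dimension being finite. *)

Section Euclidean.
Context {R : realType}.

Definition dot m (x y : 'cV[R]_m) : R := \sum_(i < m) x i 0 * y i 0.

Definition enorm m (x : 'cV[R]_m) : R := Num.sqrt (dot x x).

Definition spectral_norm n d (A : 'M[R]_(n, d)) : R :=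
  sup [set enorm (A *m x) | x in [set x : 'cV[R]_d | enorm x <= 1]].

Definition grad m (f : 'cV[R]_m -> R) (x : 'cV[R]_m) : 'cV[R]_m :=
  \col_(i < m) 'D_(delta_mx i 0) f x.

Definition smooth m (beta : R) (f : 'cV[R]_m -> R) : Prop :=
  (forall x, differentiable f x) /\
  forall x y, enorm (grad f x - grad f y) <= beta * enorm (x - y).

Definition strongly_convex m (lambda : R) (f : 'cV[R]_m -> R) : Prop :=
  convex_function setT (fun x => f x - lambda / 2 * enorm x ^+ 2).

End Euclidean.

Section ExtendedReal.
Context {R : realType} {m : nat}.
Implicit Types (g h F : 'cV[R]_m -> \bar R) (x y z w : 'cV[R]_m).
Local Open Scope ereal_scope.

Definition edom g : set 'cV[R]_m := [set x | g x < +oo].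

Definition proper_fun g : Prop := (forall x, -oo < g x) /\ edom g !=set0.

(* Restricting to the effective domain avoids +oo - oo, and is equivalent to
   convexity of the epigraph. *)
Definition econvex g : Prop := forall x y (t : R),
  edom g x -> edom g y -> (0 <= t <= 1)%R ->
  g (t *: x + (1 - t) *: y)%R <= t%:E * g x + (1 - t)%:E * g y.

Definition strictly_econvex_on (D : set 'cV[R]_m) g : Prop :=
  forall x y (t : R), D x -> D y -> x <> y -> (0 < t < 1)%R ->
  g (t *: x + (1 - t) *: y)%R < t%:E * g x + (1 - t)%:E * g y.

(* On the interior of the effective domain of a proper g, [fine \o g] agrees
   with g near each point, so this is the gradient of g there. *)
Definition egrad g : 'cV[R]_m -> 'cV[R]_m := grad (fine \o g).

Definition essentially_smooth g : Prop :=
  [/\ (edom g)° !=set0,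
      forall z, (edom g)° z -> differentiable (fine \o g) z &
      forall (u : nat -> 'cV[R]_m) z,
        (forall k, (edom g)° (u k)) ->
        (closure (edom g) `\` (edom g)°) z ->
        u @ \oo --> z ->
        enorm (egrad g (u k)) @[k --> \oo] --> +oo%R].

Definition legendre g : Prop :=
  [/\ lower_semicontinuous g, proper_fun g, econvex g,
      essentially_smooth g & strictly_econvex_on (edom g)° g].

Definition conjugate g y : \bar R :=
  ereal_sup [set (dot y x)%:E - g x | x in [set: 'cV[R]_m]].

Definition subdiff g z : set 'cV[R]_m :=
  [set v | forall w, g z + (dot v (w - z)%R)%:E <= g w].

Definition bregman h w z : \bar R :=
  h w - h z - (dot (egrad h z) (w - z)%R)%:E.

(* A function F : Z -> R is represented by its extension with value +oo
   outside Z. *)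
Definition real_valued_exactly_on (Z : set 'cV[R]_m) F : Prop :=
  (forall z, -oo < F z) /\ edom F = Z.

(* Only the values at interior points matter; on the boundary of the domain
   the subdifferential may be empty. *)
Definition subgradient_selection F (G : 'cV[R]_m -> 'cV[R]_m) : Prop :=
  forall z, (edom F)° z -> subdiff F z (G z).

Definition relatively_smooth (L : R) F (G : 'cV[R]_m -> 'cV[R]_m) h : Prop :=
  forall z w, (edom h)° z -> edom h w ->
  F w <= F z + (dot (G z) (w - z)%R)%:E + L%:E * bregman h w z.

Definition relatively_strongly_convex (lambda : R) F
    (G : 'cV[R]_m -> 'cV[R]_m) h : Prop :=
  forall z w, (edom h)° z -> edom h w ->
  F z + (dot (G z) (w - z)%R)%:E + lambda%:E * bregman h w z <= F w.

End ExtendedReal.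

Section Lifting.
Context {R : realType} {n d : nat}.
Variables (phi : 'cV[R]_n -> R) (A : 'M[R]_(n, d)) (lambda : R).

Definition phi_conj : 'cV[R]_n -> \bar R := conjugate (EFin \o phi).

Definition ridge m (x : 'cV[R]_m) : R := 2^-1 * enorm x ^+ 2.

Definition primal (x : 'cV[R]_d) : R := phi (A *m x) + lambda * ridge x.

Definition dual (y : 'cV[R]_n) : \bar R :=
  (phi_conj y + lambda%:E *
     conjugate (EFin \o @ridge d) (- lambda^-1 *: (A^T *m y))%R)%E.

(* A pair (x, y) of R^d x R^n is the stacked vector col_mx x y of R^(d + n),
   so x = usubmx z and y = dsubmx z. *)
Definition lifted (z : 'cV[R]_(d + n)) : \bar R :=
  ((primal (usubmx z))%:E + dual (dsubmx z))%E.

Definition lifted_domain : set 'cV[R]_(d + n) :=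
  [set z | edom phi_conj (dsubmx z)].

Definition reference (z : 'cV[R]_(d + n)) : \bar R :=
  ((2^-1 * enorm (usubmx z) ^+ 2)%:E + lambda^-1%:E * phi_conj (dsubmx z))%E.

End Lifting.

(* Main.v *)
From HB Require Import structures.
Require Import Defs.
From mathcomp Require Import ring lra.
Import Order.TTheory GRing.Theory Num.Theory.
Local Open Scope classical_set_scope.
Local Open Scope ring_scope.

(** Write psi for the conjugate of phi, and D_psi for its Bregman divergence.
  The Bregman divergence of h between (x', y') and (x, y) splits as
  |x' - x|^2 / 2 + D_psi(y', y) / lambda.  The lifted objective is
  f(x) + psi(y) + lambda r(-A^T y / lambda), and its first-order remainder
  splits in the same way, into
  - the remainder of f, which lies between lambda |x' - x|^2 / 2 and
    L |x' - x|^2 / 2 ([primal_ge], and [smooth_ub] with [primal_smooth]);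
  - D_psi(y', y) itself;
  - the remainder of the quadratic in y, which is
    |A^T (y' - y)|^2 / (2 lambda).
  Relative strong convexity only needs the last term to be nonnegative.
  Relative smoothness needs it to be at most
  (beta |A|^2 / lambda) D_psi(y', y), which follows from the (1/beta)-strong
  convexity of psi, i.e. |y' - y|^2 / 2 <= beta D_psi(y', y)
  ([conj_bregman_ge]), and the bound on |A^T| by the spectral norm of A.

  That strong convexity is proved as follows.  If u is a subgradient of psi at
  y, then testing the subgradient inequality at grad phi u, where psi is known
  explicitly, gives equality in the Fenchel-Young inequality at (y, u)
  ([fenchel_conjugate_subdiff]); hence y = grad phi u.
  Bounding psi(w) from below by the Fenchel-Young inequality at
  u + (w - y) / beta, and phi there from above by smoothness, gives the
  quadratic lower bound ([conjugate_strongly_convex]).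

  Both h and the lifted objective have the form k(x, y) + a psi(y) with k real
  valued and a > 0 ([block_sum]), so the domain, the convexity, the lower
  semicontinuity and the gradients are treated once for this form.  Being
  essentially smooth is inherited by h from psi because the norm of its gradient
  dominates that of grad psi / lambda.  Finally, at interior points the lifted
  objective is differentiable, so its gradient is its only subgradient, and the
  relative inequalities for an arbitrary selection reduce to those for the
  gradient. *)

Set Implicit Arguments.
Unset Strict Implicit.
Unset Printing Implicit Defensive.

(** * Euclidean norm and spectral norm *)

Section EuclideanAlgebra.
Context {R : realType}.

Lemma dotE m (x y : 'cV[R]_m) : dot x y = (x^T *m y) 0 0.
Proof. by rewrite mxE; apply: eq_bigr => i _; rewrite mxE. Qed.

Lemma dotC m (x y : 'cV[R]_m) : dot x y = dot y x.
Proof. by apply: eq_bigr => i _; rewrite mulrC. Qed.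

Lemma dotDr m (x y z : 'cV[R]_m) : dot x (y + z) = dot x y + dot x z.
Proof. by rewrite !dotE mulmxDr mxE. Qed.

Lemma dotZr m a (x y : 'cV[R]_m) : dot x (a *: y) = a * dot x y.
Proof. by rewrite !dotE -scalemxAr mxE. Qed.

Lemma dotNr m (x y : 'cV[R]_m) : dot x (- y) = - dot x y.
Proof. by rewrite -scaleN1r dotZr mulN1r. Qed.

Lemma dotDl m (x y z : 'cV[R]_m) : dot (x + y) z = dot x z + dot y z.
Proof. by rewrite dotC dotDr !(dotC z). Qed.

Lemma dotZl m a (x y : 'cV[R]_m) : dot (a *: x) y = a * dot x y.
Proof. by rewrite dotC dotZr dotC. Qed.

Lemma dotNl m (x y : 'cV[R]_m) : dot (- x) y = - dot x y.
Proof. by rewrite dotC dotNr dotC. Qed.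

Definition dot_linE := (dotDl, dotDr, dotNl, dotNr, dotZl, dotZr).

Lemma dot_mulmx n d (A : 'M[R]_(n, d)) (u : 'cV[R]_n) (v : 'cV[R]_d) :
  dot u (A *m v) = dot (A^T *m u) v.
Proof. by rewrite !dotE trmx_mul trmxK mulmxA. Qed.

Lemma dot_col_mx m p (x x' : 'cV[R]_m) (y y' : 'cV[R]_p) :
  dot (col_mx x y) (col_mx x' y') = dot x x' + dot y y'.
Proof. by rewrite !dotE tr_col_mx mul_row_col mxE. Qed.

Lemma dot_blocks d n (z g : 'cV[R]_(d + n)) :
  dot g z = dot (usubmx g) (usubmx z) + dot (dsubmx g) (dsubmx z).
Proof. by rewrite -dot_col_mx !vsubmxK. Qed.

Lemma dot_ge0 m (x : 'cV[R]_m) : 0 <= dot x x.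
Proof. by apply: sumr_ge0 => i _; rewrite -expr2 sqr_ge0. Qed.

Lemma dot_eq0 m (x : 'cV[R]_m) : (dot x x == 0) = (x == 0).
Proof.
apply/idP/eqP => [|->]; last by rewrite dotE mulmx0 mxE.
rewrite psumr_eq0 => [/allP xx0|i _]; last by rewrite -expr2 sqr_ge0.
apply/colP => i; rewrite mxE; apply/eqP.
by have := xx0 i (mem_index_enum _); rewrite -expr2 sqrf_eq0.
Qed.

Lemma dot_gt0 m (x : 'cV[R]_m) : x != 0 -> 0 < dot x x.
Proof. by move=> x0; rewrite lt_def dot_eq0 x0 dot_ge0. Qed.

Lemma enorm_ge0 m (x : 'cV[R]_m) : 0 <= enorm x.
Proof. exact: sqrtr_ge0. Qed.

Lemma sqr_enorm m (x : 'cV[R]_m) : enorm x ^+ 2 = dot x x.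
Proof. by rewrite sqr_sqrtr ?dot_ge0. Qed.

Lemma ler_enorm m p (x : 'cV[R]_m) (y : 'cV[R]_p) :
  (enorm x <= enorm y) = (dot x x <= dot y y).
Proof. by rewrite ler_sqrt ?dot_ge0. Qed.

Lemma enormZ m a (x : 'cV[R]_m) : enorm (a *: x) = `|a| * enorm x.
Proof.
by rewrite /enorm dotZl dotZr mulrA -expr2 sqrtrM ?sqr_ge0// sqrtr_sqr.
Qed.

(** Expanding the squared norm of (y.y) x - (x.y) y, which vanishes exactly when
  x and y are proportional. *)
Lemma cauchy_schwarz m (x y : 'cV[R]_m) : `|dot x y| <= enorm x * enorm y.
Proof.
rewrite -(@ler_pXn2r _ 2) ?nnegrE// ?mulr_ge0 ?enorm_ge0//.
rewrite real_normK ?num_real// exprMn !sqr_enorm.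
have [->|/dot_gt0 y0] := eqVneq y 0.
  by rewrite !dotE !mulmx0 mxE expr0n mulr0.
rewrite -(ler_pM2l y0) -subr_ge0.
have := dot_ge0 (dot y y *: x - dot x y *: y).
rewrite !dot_linE (dotC y x) => /le_trans; apply.
by rewrite le_eqVlt; apply/orP; left; apply/eqP; ring.
Qed.

Lemma enormD m (x y : 'cV[R]_m) : enorm (x + y) <= enorm x + enorm y.
Proof.
rewrite -(@ler_pXn2r _ 2) ?nnegrE// ?addr_ge0 ?enorm_ge0//.
rewrite sqrrD !sqr_enorm !dot_linE (dotC y x).
by have := le_trans (ler_norm _) (cauchy_schwarz x y); lra.
Qed.

(** The supremum defining the spectral norm is meaningful only for a bounded
  set.  Bounding each coordinate of A x by Cauchy-Schwarz shows that the
  Frobenius norm of A is an upper bound. *)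
Lemma has_sup_spectral n d (A : 'M[R]_(n, d)) :
  has_sup [set enorm (A *m x) | x in [set x : 'cV[R]_d | enorm x <= 1]].
Proof.
split.
  exists (enorm (A *m 0)), 0 => //=.
  by rewrite /enorm dotE mulmx0 mxE sqrtr0.
exists (Num.sqrt (\sum_(i < n) dot (row i A)^T (row i A)^T)) => _ [x /= x1 <-].
rewrite ler_sqrt; last by rewrite sumr_ge0// => i _; rewrite dot_ge0.
apply: ler_sum => i _.
have -> : (A *m x) i 0 = dot (row i A)^T x.
  by rewrite dotE trmxK -row_mul [RHS]mxE.
rewrite -expr2 -real_normK ?num_real// -[leRHS]sqr_enorm.
rewrite ler_pXn2r ?nnegrE ?enorm_ge0//.
by apply: le_trans (cauchy_schwarz _ _) _; rewrite ler_piMr ?enorm_ge0.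
Qed.

Lemma spectral_norm_ge0 n d (A : 'M[R]_(n, d)) : 0 <= spectral_norm A.
Proof.
apply: le_trans (enorm_ge0 (A *m 0)) _.
apply: sup_upper_bound (has_sup_spectral A) _ _; exists 0 => //=.
by rewrite /enorm dotE mulmx0 mxE sqrtr0.
Qed.

Lemma enorm_mulmx n d (A : 'M[R]_(n, d)) (x : 'cV[R]_d) :
  enorm (A *m x) <= spectral_norm A * enorm x.
Proof.
have [->|x0] := eqVneq x 0.
  by rewrite mulmx0 /enorm !dotE !mulmx0 !mxE sqrtr0 mulr0.
have ex0 : 0 < enorm x by rewrite sqrtr_gt0 dot_gt0.
rewrite -ler_pdivrMr// mulrC -[_^-1]ger0_norm ?invr_ge0 ?enorm_ge0//.
rewrite -enormZ scalemxAr.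
apply: sup_upper_bound (has_sup_spectral A) _ _; eexists; last reflexivity.
by rewrite /= enormZ ger0_norm ?invr_ge0 ?enorm_ge0// mulVf// gt_eqF.
Qed.

(** The norm of A also bounds its transpose: |A^T v|^2 = v.(A A^T v), and
  one factor |A^T v| cancels after Cauchy-Schwarz. *)
Lemma enorm_trmulmx n d (A : 'M[R]_(n, d)) (v : 'cV[R]_n) :
  enorm (A^T *m v) <= spectral_norm A * enorm v.
Proof.
have [e0|ne0] := eqVneq (enorm (A^T *m v)) 0.
  by rewrite e0 mulr_ge0 ?spectral_norm_ge0 ?enorm_ge0.
have e0 : 0 < enorm (A^T *m v) by rewrite lt_def ne0 enorm_ge0.
rewrite -(ler_pM2r e0) -expr2 sqr_enorm -dot_mulmx.
apply: le_trans (ler_norm _) _; apply: le_trans (cauchy_schwarz _ _) _.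
by rewrite mulrAC [leRHS]mulrC ler_wpM2l ?enorm_ge0 ?enorm_mulmx.
Qed.

End EuclideanAlgebra.

(** * Gradients *)

Section Gradient.
Context {R : realType}.

Lemma mulmx_continuous n d (A : 'M[R]_(n, d)) :
  continuous (fun x : 'cV[R]_d => A *m x).
Proof.
move=> x B [P Px PB]; rewrite nbhs_simpl/=.
suff : \forall y \near x, forall i j, P i j ((A *m y) i j).
  by apply: filterS => y Py; exact: PB.
apply: (@filter_forall _ _
  (fun i y => forall j, P i j ((A *m y) i j)) (nbhs x)) => i.
apply: (@filter_forall _ _ (fun j y => P i j ((A *m y) i j)) (nbhs x)) => j.
have cAij : {for x, continuous (fun y : 'cV[R]_d => (A *m y) i j)}.
  have -> : (fun y : 'cV[R]_d => (A *m y) i j) =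
            \sum_k (fun y : 'cV[R]_d => A i k * y k j).
    by apply/funext => y; rewrite mxE fct_sumE.
  apply/differentiable_continuous/differentiable_sum => k.
  by apply: differentiableM => //; exact: differentiable_coord.
exact: cAij (Px i j).
Qed.

Lemma is_diff_mulmx n d (A : 'M[R]_(n, d)) (x : 'cV[R]_d) :
  is_diff x (mulmx A : 'cV[R]_d -> 'cV[R]_n) (mulmx A).
Proof.
apply: DiffDef; first exact/linear_differentiable/mulmx_continuous.
exact/diff_lin/mulmx_continuous.
Qed.

(** Differentiability is local.  This is needed because an identity between
  extended-real functions only passes to their [fine] parts where they are
  finite, hence near interior points of the domain. *)
Lemma is_diff_near (V W : normedModType R) (f g df : V -> W) x :
  (\forall y \near x, f y = g y) -> is_diff x f df -> is_diff x g df.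
Proof.
move=> fg [fx <-].
have fgx : f x = g x by exact: nbhs_singleton fg.
have gx : g \o shift x = cst (g x) + 'd f x +o_ 0 id.
  apply/eqaddoP => e e0; have /eqaddoP/(_ e e0) := diff_locally fx.
  have : \forall h \near (0 : V), f (h + x) = g (h + x).
    by move: fg; rewrite (near_shift 0 x) /= subr0.
  apply: filterS2 => h.
  by rewrite !fctE/= => <-; rewrite fgx.
have dgE : 'd g x = 'd f x :> (V -> W).
  by apply: diff_unique gx; exact: diff_continuous.
apply: DiffDef => //; apply/diff_locallyP; rewrite dgE; split=> //.
exact: diff_continuous.
Qed.

(** Throughout, having gradient g at x is written [is_diff x f (dot g)], which
  bundles differentiability with the value of the gradient and composes through
  the chain rule; this lemma and [gradE] translate to and from [grad]. *)
Lemma is_diff_grad m (f : 'cV[R]_m -> R) x :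
  differentiable f x -> is_diff x f (dot (grad f x)).
Proof.
move=> fx; apply: DiffDef => //; apply/funext => v.
have {1}-> : v = \sum_i v i 0 *: delta_mx i 0.
  rewrite [LHS]matrix_sum_delta; apply: eq_bigr => i _.
  by rewrite big_ord1.
rewrite linear_sum; apply: eq_bigr => i _.
by rewrite linearZ /= mxE deriveE// mulrC.
Qed.

Lemma gradE m (f : 'cV[R]_m -> R) x g : is_diff x f (dot g) -> grad f x = g.
Proof.
move=> [fx dfx]; apply/colP => i; rewrite mxE deriveE// dfx /dot (bigD1 i)//=.
rewrite big1 => [|j ji]; first by rewrite mxE !eqxx mulr1 addr0.
by rewrite mxE (negPf ji) mulr0.
Qed.

Lemma is_diff_comp_mulmx n d (f : 'cV[R]_n -> R) (A : 'M[R]_(n, d)) x g :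
  is_diff (A *m x) f (dot g) ->
  is_diff x (fun y => f (A *m y)) (dot (A^T *m g)).
Proof.
move=> fx; have Ax := is_diff_mulmx A x.
apply: is_diff_eq (is_diff_comp Ax fx) _.
by apply/funext => v; rewrite /= dot_mulmx.
Qed.

Lemma is_diff_dotD m (f g : 'cV[R]_m -> R) x u v :
  is_diff x f (dot u) -> is_diff x g (dot v) ->
  is_diff x (fun y => f y + g y) (dot (u + v)).
Proof.
move=> fx gx; apply: is_diff_eq (is_diffD fx gx) _.
by apply/funext => w; rewrite dotDl.
Qed.

Lemma is_diff_dotZ m (f : 'cV[R]_m -> R) a x u :
  is_diff x f (dot u) -> is_diff x (fun y => a * f y) (dot (a *: u)).
Proof.
move=> fx; apply: is_diff_eq (is_diffZ a fx) _.
by apply/funext => w; rewrite dotZl.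
Qed.

Lemma is_diff_ridge m (x : 'cV[R]_m) : is_diff x (@ridge R m) (dot x).
Proof.
have coordx i : is_diff x (fun y : 'cV[R]_m => y i 0) (fun y => y i 0).
  have clin : linear (fun y : 'cV[R]_m => y i 0) by move=> a u v; rewrite !mxE.
  pose cM := GRing.isLinear.Build _ _ _ _ _ clin.
  pose cL : {linear 'cV[R]_m -> R} := HB.pack (fun y : 'cV[R]_m => y i 0) cM.
  apply: DiffDef; first exact: differentiable_coord.
  by apply: (@diff_lin _ _ _ cL); exact: coord_continuous.
have sumx (r : seq 'I_m) : is_diff x (fun y => \sum_(i <- r) y i 0 * y i 0)
    (fun v => \sum_(i <- r) 2 * (x i 0 * v i 0)).
  elim: r => [|i r IHr].
    under eq_fun do rewrite big_nil.
    under [X in is_diff _ _ X]eq_fun do rewrite big_nil.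
    exact: is_diff_cst.
  under eq_fun do rewrite big_cons.
  under [X in is_diff _ _ X]eq_fun do rewrite big_cons.
  apply: is_diff_eq (is_diffD (is_diffM (coordx i) (coordx i)) IHr) _.
  by apply/funext => v; rewrite /= mulr_natl mulr2n.
have -> : @ridge R m = 2^-1 *: (fun y => \sum_i y i 0 * y i 0).
  by apply/funext => y; rewrite /ridge sqr_enorm.
apply: is_diff_eq (is_diffZ _ (sumx _)) _.
apply/funext => v; rewrite -[LHS]/(2^-1 * _).
by rewrite -mulr_sumr mulKf ?pnatr_eq0.
Qed.

End Gradient.

(** * First-order inequalities *)

Section FirstOrder.
Context {R : realType} {m : nat}.
Implicit Types (f : 'cV[R]_m -> R) (x v w g : 'cV[R]_m).

(** Only right difference quotients are used, so the hypothesis may hold on one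
  side of x only, as it does along a segment leading to the boundary of a
  domain. *)
Lemma dot_grad_le f x g v c : is_diff x f (dot g) ->
  (\forall t \near 0^'+, f (x + t *: v) <= f x + t * c) -> dot g v <= c.
Proof.
move=> [fx dfx] fle.
have : derivable f x v by exact: diff_derivable.
rewrite /derivable -/(derive f x v) => /cvg_dnbhs_at_right.
rewrite deriveE// dfx.
move=> /cvgr_to_le; apply.
near=> t.
have t0 : 0 < t by near: t; exact: nbhs_right_gt.
rewrite /= -[_ *: _]/(_ * _) ler_pdivrMl// lerBlDl [t *: v + x]addrC.
by near: t.
Unshelve. all: by end_near. Qed.

(** Moving from x in the direction v - g, the affine minorant grows at rate
  v.(v - g) and f at rate g.(v - g), so |v - g|^2 <= 0. *)
Lemma subgradient_grad f x g v : is_diff x f (dot g) ->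
  (\forall w \near x, f x + dot v (w - x) <= f w) -> v = g.
Proof.
move=> fx fge; apply/eqP; rewrite -subr_eq0 -dot_eq0 eq_le dot_ge0 andbT.
have negfx := is_diff_dotZ (-1) fx.
suff : dot (-1 *: g) (v - g) <= - dot v (v - g).
  by rewrite !dot_linE (dotC v g); lra.
apply: (dot_grad_le negfx).
have cvgx : x + t *: (v - g) @[t --> 0^'+] --> x.
  apply: cvg_at_right_filter.
  have {2}-> : x = x + 0 *: (v - g) by rewrite scale0r addr0.
  apply: cvgD; first exact: cvg_cst.
  by apply: cvgZr_tmp; exact: cvg_id.
have fline : \forall t \near 0^'+,
  f x + dot v (x + t *: (v - g) - x) <= f (x + t *: (v - g)) := cvgx _ fge.
near=> t.
have : f x + dot v (x + t *: (v - g) - x) <= f (x + t *: (v - g)) by near: t.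
rewrite [x + _ - x]addrC addKr dotZr; lra.
Unshelve. all: by end_near. Qed.

Lemma dot_grad_le_secant f x w g : is_diff x f (dot g) ->
  (forall t, 0 < t < 1 ->
    f (t *: w + (1 - t) *: x) <= t * f w + (1 - t) * f x) ->
  f x + dot g (w - x) <= f w.
Proof.
move=> fx fle; rewrite -lerBrDl; apply: (dot_grad_le fx).
near=> t.
have -> : x + t *: (w - x) = t *: w + (1 - t) *: x.
  by rewrite scalerBr scalerBl scale1r addrCA.
apply: le_trans (fle t _) _; last by lra.
by apply/andP; split; near: t; [exact: nbhs_right_gt|exact: nbhs_right_lt].
Unshelve. all: by end_near. Qed.

(** Along the segment from x to w, the gap between f and the quadratic bound has
  derivative (grad f (x + t v) - grad f x).v - beta t |v|^2, which is at most 0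
  by Cauchy-Schwarz and the Lipschitz bound on the gradient. *)
Lemma smooth_ub beta f x w : smooth beta f ->
  f w <= f x + dot (grad f x) (w - x) + beta / 2 * dot (w - x) (w - x).
Proof.
move=> [fdiff flip]; set v := w - x.
pose gap (t : R) :=
  f (x + t *: v) - (t * dot (grad f x) v + t ^+ 2 * (beta / 2 * dot v v)).
have dgap (t : R) : is_derive t 1 gap
    (dot (grad f (x + t *: v)) v -
     (dot (grad f x) v + 2 * t * (beta / 2 * dot v v))).
  have fline : is_derive t 1 (fun s => f (x + s *: v))
      (dot (grad f (x + t *: v)) v).
    have line : is_diff t (fun s : R => x + s *: v) ( *:%R ^~ v).
      apply: is_diff_eq (is_diffD (is_diff_cst _ _) (is_diff_scalel t v)) _.
      by apply/funext => s /=; rewrite add0r.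
    have [d1 d2] := is_diff_comp line (is_diff_grad (fdiff (x + t *: v))).
    split; first exact: diff_derivable.
    by rewrite deriveE// d2 /= scale1r.
  rewrite /gap.
  apply: is_derive_eq; rewrite /GRing.scale/=; ring.
suff : gap 1 <= gap 0.
  have xv : x + v = w by rewrite addrC subrK.
  rewrite /gap scale1r scale0r addr0 xv; lra.
apply: (@ler0_derive1_le_cc _ gap 0 1); rewrite ?in_itv/= ?lexx ?ler01//.
- move=> t; rewrite in_itv/= => /andP[t0 _]; rewrite derive1E derive_val.
  have /(le_trans (ler_norm _)) :=
    cauchy_schwarz (grad f (x + t *: v) - grad f x) v.
  have := flip (x + t *: v) x.
  rewrite [x + _]addrC addrK enormZ (gtr0_norm t0) -(sqr_enorm v) dotDl dotNl.
  have := enorm_ge0 v; nra.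
- apply: continuous_subspaceT => t.
  exact/differentiable_continuous/derivable1_diffP.
Qed.

End FirstOrder.

(** * Convex functions and half the squared norm *)

Section ConvexFunctions.
Context {R : realType} {m : nat}.

Lemma convex_functionP (f : 'cV[R]_m -> R) :
  convex_function setT f <-> forall x y t, 0 <= t <= 1 ->
    f (t *: x + (1 - t) *: y) <= t * f x + (1 - t) * f y.
Proof.
split=> [cf x y t /andP[t0 t1]|cf t x y _ _]; last first.
  by apply: (cf x y t%:num); apply/andP; split.
by have := cf (Itv01 t0 t1) x y; rewrite !in_setE; apply.
Qed.

Lemma convex_grad_le (f : 'cV[R]_m -> R) x w : convex_function setT f ->
  differentiable f x -> f x + dot (grad f x) (w - x) <= f w.
Proof.
move=> /convex_functionP cf fx; apply: dot_grad_le_secant (is_diff_grad fx) _.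
by move=> t /andP[t0 t1]; apply: cf; rewrite !ltW.
Qed.

Lemma ridge_conv (x y : 'cV[R]_m) t :
  ridge (t *: x + (1 - t) *: y) =
  t * ridge x + (1 - t) * ridge y - t * (1 - t) * ridge (x - y).
Proof. by rewrite /ridge !sqr_enorm !dot_linE (dotC y x); field. Qed.

Lemma ridgeB (x w : 'cV[R]_m) :
  ridge w - ridge x - dot x (w - x) = ridge (w - x).
Proof. by rewrite /ridge !sqr_enorm !dot_linE (dotC w x); field. Qed.

Lemma ridge_ge0 (x : 'cV[R]_m) : 0 <= ridge x.
Proof. by rewrite mulr_ge0 ?invr_ge0 ?sqr_ge0. Qed.

Lemma ridge_gt0 (x : 'cV[R]_m) : x != 0 -> 0 < ridge x.
Proof. by move=> x0; rewrite mulr_gt0 ?invr_gt0 ?ltr0n// sqr_enorm dot_gt0. Qed.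

Lemma ridge_convex (x y : 'cV[R]_m) t : 0 <= t <= 1 ->
  ridge (t *: x + (1 - t) *: y) <= t * ridge x + (1 - t) * ridge y.
Proof.
move=> /andP[t0 t1]; rewrite ridge_conv gerBl.
by rewrite mulr_ge0 ?ridge_ge0// mulr_ge0// subr_ge0.
Qed.

(** y.x - r(x) = r(y) - r(x - y), so the supremum is attained at x = y. *)
Lemma conjugate_ridge (y : 'cV[R]_m) :
  conjugate (EFin \o @ridge R m) y = (ridge y)%:E.
Proof.
apply/eqP; rewrite eq_le; apply/andP; split.
  apply/ereal_supP => _ [x _ <-] /=; rewrite -EFinB lee_fin.
  have := ridge_ge0 (x - y).
  by rewrite -ridgeB /ridge !sqr_enorm !dot_linE; lra.
apply: ereal_sup_ubound; exists y => //=.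
by rewrite -EFinB /ridge sqr_enorm; congr (_%:E); field.
Qed.

End ConvexFunctions.

(** * Strong convexity of the conjugate of a smooth convex function *)

Section Conjugate.
Context {R : realType} {n : nat}.
Implicit Types (f : 'cV[R]_n -> R) (psi : 'cV[R]_n -> \bar R).

Lemma fenchel_young f y w :
  ((dot y w)%:E - (f w)%:E <= conjugate (EFin \o f) y)%E.
Proof. by apply: ereal_sup_ubound; exists w. Qed.

(** The function w |-> v.w - f(w) with v = grad f u is maximal at w = u, by the
  gradient inequality for f. *)
Lemma conjugate_grad f u : convex_function setT f -> differentiable f u ->
  (conjugate (EFin \o f) (grad f u) <= (dot (grad f u) u - f u)%:E)%E.
Proof.
move=> cf fu; apply/ereal_supP => _ [w _ <-] /=.
rewrite -EFinB lee_fin.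
by have := convex_grad_le w cf fu; rewrite !dot_linE; lra.
Qed.

(** The reverse of the Fenchel-Young inequality.  The subgradient inequality at
  grad f u, where the conjugate is bounded by [conjugate_grad], rearranges to
  it. *)
Lemma fenchel_conjugate_subdiff f y u : convex_function setT f ->
  differentiable f u -> subdiff (conjugate (EFin \o f)) y u ->
  (conjugate (EFin \o f) y <= (dot y u - f u)%:E)%E.
Proof.
move=> cf fu uy.
have := le_trans (uy (grad f u)) (conjugate_grad cf fu).
rewrite -leeBrDr// -EFinB => /le_trans; apply; rewrite lee_fin.
by rewrite !dot_linE (dotC u) (dotC u y); lra.
Qed.

(** Fenchel-Young at w and v = u + (w - y) / beta bounds the conjugate at w from
  below by w.v - f(v).  Since y = grad f u, smoothness bounds f(v) from above by
  f(u) + y.(v - u) + beta |v - u|^2 / 2, and this choice of v is the one that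
  maximizes the resulting bound. *)
Lemma conjugate_strongly_convex beta f y u w : convex_function setT f ->
  0 < beta -> smooth beta f -> subdiff (conjugate (EFin \o f)) y u ->
  (conjugate (EFin \o f) y + (dot u (w - y) + beta^-1 * ridge (w - y))%:E <=
   conjugate (EFin \o f) w)%E.
Proof.
move=> cf beta0 fsmooth uy; have fu := fsmooth.1 u.
have yu := fenchel_conjugate_subdiff cf fu uy.
have y_grad : y = grad f u.
  apply: subgradient_grad (is_diff_grad fu) _; near=> v.
  have := le_trans (fenchel_young f y v) yu.
  by rewrite -EFinB lee_fin dotDr dotNr; lra.
apply: le_trans (leeD2r _ yu) _.
apply: le_trans (fenchel_young f w (u + beta^-1 *: (w - y))).
rewrite -EFinD -EFinB lee_fin.
have := smooth_ub u (u + beta^-1 *: (w - y)) fsmooth.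
rewrite -y_grad [u + _]addrC addrK => ub; rewrite /ridge sqr_enorm.
suff -> : dot y u - f u +
    (dot u (w - y) + beta^-1 * (2^-1 * dot (w - y) (w - y))) =
  dot w (beta^-1 *: (w - y) + u) - (f u + dot y (beta^-1 *: (w - y)) +
  beta / 2 * dot (beta^-1 *: (w - y)) (beta^-1 *: (w - y))) by lra.
rewrite !dot_linE (dotC u w) (dotC u y) (dotC y w); field.
by rewrite gt_eqF.
Unshelve. all: by end_near. Qed.

End Conjugate.

(** * Gradients of extended-real convex functions *)

Section Subdiff.
Context {R : realType} {m : nat}.

Lemma edom_fineK (g : 'cV[R]_m -> \bar R) y :
  (forall x, -oo < g x)%E -> edom g y -> g y = (fine (g y))%:E.
Proof. by move=> gNy gy; rewrite fineK// fin_real// gNy. Qed.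

(** The secant inequality of [dot_grad_le_secant] only involves points of the
  effective domain, so it also covers w on the boundary of the domain; outside
  the domain the subgradient inequality is void. *)
Lemma grad_subdiff (g : 'cV[R]_m -> \bar R) z u :
  (forall y, -oo < g y)%E -> econvex g -> edom g z ->
  is_diff z (fine \o g) (dot u) -> subdiff g z u.
Proof.
move=> gtNy cg zdom gz w.
have [wdom|] := boolP (g w < +oo)%E; last first.
  by rewrite ltey negbK => /eqP ->; exact: leey.
rewrite (edom_fineK gtNy zdom) (edom_fineK gtNy wdom) -EFinD lee_fin.
apply: (dot_grad_le_secant gz) => t /andP[t0 t1].
have t01 : 0 <= t <= 1 by rewrite !ltW.
have := cg _ _ _ wdom zdom t01.
rewrite (edom_fineK gtNy zdom) (edom_fineK gtNy wdom) -!EFinM -EFinD => cvx.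
have tdom : edom g (t *: w + (1 - t) *: z).
  by apply: le_lt_trans cvx _; exact: ltry.
by move: cvx; rewrite (edom_fineK gtNy tdom) lee_fin.
Qed.

End Subdiff.

(** * Topology and gradients of stacked vectors *)

Section Blocks.
Context {R : realType} {d n : nat}.
Implicit Types (z w : 'cV[R]_(d + n)) (D : set 'cV[R]_n).

(** Writing the two projections as matrix products reduces their continuity and
  the chain rule through them to the case of matrices. *)
Lemma usubmxE z : usubmx z = row_mx 1%:M 0 *m z.
Proof. by rewrite -{2}[z]vsubmxK mul_row_col mul1mx mul0mx addr0. Qed.

Lemma dsubmxE z : dsubmx z = row_mx 0 1%:M *m z.
Proof. by rewrite -{2}[z]vsubmxK mul_row_col mul1mx mul0mx add0r. Qed.

Lemma is_diff_usubmx (f : 'cV[R]_d -> R) z g : is_diff (usubmx z) f (dot g) ->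
  is_diff z (fun w => f (usubmx w)) (dot (col_mx g 0)).
Proof.
rewrite usubmxE => /is_diff_comp_mulmx.
rewrite tr_row_mx trmx1 trmx0 mul_col_mx mul1mx mul0mx.
by under [X in _ -> is_diff _ X _]eq_fun do rewrite usubmxE.
Qed.

Lemma is_diff_dsubmx (f : 'cV[R]_n -> R) z g : is_diff (dsubmx z) f (dot g) ->
  is_diff z (fun w => f (dsubmx w)) (dot (col_mx 0 g)).
Proof.
rewrite dsubmxE => /is_diff_comp_mulmx.
rewrite tr_row_mx trmx1 trmx0 mul_col_mx mul1mx mul0mx.
by under [X in _ -> is_diff _ X _]eq_fun do rewrite dsubmxE.
Qed.

Lemma dsubmx_continuous : continuous (dsubmx : 'cV[R]_(d + n) -> 'cV[R]_n).
Proof.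
rewrite (_ : dsubmx = mulmx (row_mx 0 1%:M)); first exact: mulmx_continuous.
by apply/funext => z; rewrite dsubmxE.
Qed.

Lemma col_mx_continuous (x : 'cV[R]_d) :
  continuous (fun y : 'cV[R]_n => col_mx x y).
Proof.
have -> : (fun y : 'cV[R]_n => col_mx x y) =
    (fun y => col_mx x 0 + col_mx 0 1%:M *m y).
  by apply/funext => y; rewrite mul_col_mx mul1mx mul0mx add_col_mx addr0 add0r.
move=> y; set B := col_mx 0 _.
have cB : {for y, continuous (fun y : 'cV[R]_n => B *m y)}.
  exact: mulmx_continuous.
have cx : {for y, continuous (fun _ : 'cV[R]_n => col_mx x 0 : 'cV[R]_(d + n))}.
  exact: cst_continuous.
exact: (continuousD cx cB).
Qed.

(** One inclusion is the continuity of the projection, the other one that of its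
  sections y |-> (x, y). *)
Lemma interior_dsubmx D :
  (dsubmx @^-1` D)° = dsubmx @^-1` D° :> set 'cV[R]_(d + n).
Proof.
apply/seteqP; split=> z.
  rewrite /interior /= -{1}[z]vsubmxK => /col_mx_continuous.
  rewrite nbhs_simpl/=.
  by apply: filterS => y /=; rewrite col_mxKd.
exact: dsubmx_continuous.
Qed.

Lemma closure_dsubmx D :
  closure (dsubmx @^-1` D) `<=` (dsubmx @^-1` closure D : set 'cV[R]_(d + n)).
Proof.
move=> z clz B /dsubmx_continuous /clz [w [Dw Bw]].
by exists (dsubmx w).
Qed.

End Blocks.

(** * Functions of the form k(z) + a psi(y) *)

Section BlockSum.
Context {R : realType} {d n : nat}.
Variables (k : 'cV[R]_(d + n) -> R) (a : R) (psi : 'cV[R]_n -> \bar R).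

Definition block_sum z : \bar R := ((k z)%:E + a%:E * psi (dsubmx z))%E.

Hypothesis a_gt0 : 0 < a.
Hypothesis psi_gtNy : forall y, (-oo < psi y)%E.

Lemma block_sum_fin z : edom psi (dsubmx z) ->
  block_sum z = (k z + a * fine (psi (dsubmx z)))%:E.
Proof.
by rewrite /block_sum => /(edom_fineK psi_gtNy) ->; rewrite EFinD EFinM.
Qed.

Lemma block_sum_gtNy z : (-oo < block_sum z)%E.
Proof.
have [psiz|] := boolP (psi (dsubmx z) < +oo)%E.
  by rewrite block_sum_fin// ltNyr.
by rewrite ltey negbK /block_sum => /eqP ->; rewrite gt0_muley ?lte_fin.
Qed.

Lemma edom_block_sum : edom block_sum = dsubmx @^-1` edom psi.
Proof.
apply/seteqP; split=> z; last first.
  by rewrite /= => psiz; rewrite /edom/= block_sum_fin// ltry.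
have [//|] := boolP (psi (dsubmx z) < +oo)%E.
rewrite ltey negbK /edom /block_sum /= => /eqP ->.
by rewrite gt0_muley ?lte_fin.
Qed.

Lemma block_sum_econvex :
  (forall z w t, 0 <= t <= 1 ->
    k (t *: z + (1 - t) *: w) <= t * k z + (1 - t) * k w) ->
  econvex psi -> econvex block_sum.
Proof.
move=> ck cpsi z w t; rewrite edom_block_sum => /= psiz psiw t01.
have := cpsi _ _ _ psiz psiw t01.
rewrite (edom_fineK psi_gtNy psiz) (edom_fineK psi_gtNy psiw).
rewrite -!EFinM -EFinD => cvx.
have psit : edom psi (dsubmx (t *: z + (1 - t) *: w)).
  by rewrite /edom/= linearD !linearZ /=; apply: le_lt_trans cvx _; exact: ltry.
rewrite !block_sum_fin// -!EFinM -EFinD lee_fin.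
move: cvx; rewrite -[t *: dsubmx z]linearZ -[_ *: dsubmx w]linearZ -linearD /=.
rewrite (edom_fineK psi_gtNy psit) lee_fin => /(ler_wpM2l (ltW a_gt0)).
have := ck z w _ t01; rewrite /=; lra.
Qed.

(** If s < k(z) + a psi(y), then some r < psi(y) has s < k(z) + a r.  Near z,
  both s - a r < k and r < psi persist. *)
Lemma block_sum_lsc : continuous k -> lower_semicontinuous psi ->
  lower_semicontinuous block_sum.
Proof.
move=> kc psilsc z s sz.
have [r [r1 r2]] : exists r : R, (r%:E < psi (dsubmx z))%E /\ s < k z + a * r.
  have [psiz|] := boolP (psi (dsubmx z) < +oo)%E.
    move: sz; rewrite block_sum_fin// lte_fin (edom_fineK psi_gtNy psiz) /=.
    set c := fine _ => sz; exists (((s - k z) / a + c) / 2).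
    have : (s - k z) / a < c by rewrite ltr_pdivrMr// mulrC; lra.
    move=> sc; split; first by rewrite lte_fin; lra.
    by rewrite -ltrBlDl mulrC -ltr_pdivrMr//; lra.
  rewrite ltey negbK => /eqP ->; exists ((s + 1 - k z) / a); split=> //.
    by rewrite ltry.
  by rewrite mulrC divfK ?gt_eqF//; lra.
have [V Vz Vpsi] := psilsc _ _ r1.
exists ([set w | s - a * r < k w] `&` dsubmx @^-1` V).
  have kz : nbhs z [set w | s - a * r < k w].
    have skz : s - a * r < k z by lra.
    exact: kc (lt_nbhsr skz).
  have psiz : nbhs z (dsubmx @^-1` V) by exact: dsubmx_continuous.
  exact: filterI kz psiz.
move=> w [/= kw /Vpsi psiw].
apply: (@lt_le_trans _ _ ((k w + a * r)%:E)); first by rewrite lte_fin; lra.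
rewrite /block_sum EFinD leeD2l// EFinM.
by rewrite lee_pmul2l ?lte_fin// ltW.
Qed.

Lemma is_diff_block_sum z g u : (edom block_sum)° z ->
  is_diff z k (dot g) -> is_diff (dsubmx z) (fine \o psi) (dot u) ->
  is_diff z (fine \o block_sum) (dot (g + a *: col_mx 0 u)).
Proof.
move=> zint kz psiz.
apply: (@is_diff_near _ _ _
  (fun w => k w + a * (fine \o psi) (dsubmx w))); last first.
  by apply: is_diff_dotD => //; apply: is_diff_dotZ; exact: is_diff_dsubmx.
move: zint; rewrite edom_block_sum; apply: filterS => w /= psiw.
by rewrite block_sum_fin.
Qed.

End BlockSum.

(** * The reference function *)

Section RidgeBlock.
Context {R : realType} {d n : nat}.
Variables (a : R) (psi : 'cV[R]_n -> \bar R).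
Hypothesis a_gt0 : 0 < a.
Hypothesis psi_legendre : legendre psi.

Definition ridge_block : 'cV[R]_(d + n) -> \bar R :=
  block_sum (fun z => ridge (usubmx z)) a psi.

Let psi_gtNy : forall y, (-oo < psi y)%E.
Proof. by have [_ []] := psi_legendre. Qed.

Lemma interior_edom_ridge_block z :
  (edom ridge_block)° z <-> (edom psi)° (dsubmx z).
Proof. by rewrite /ridge_block edom_block_sum// interior_dsubmx. Qed.

Lemma is_diff_ridge_block z : (edom ridge_block)° z ->
  is_diff z (fine \o ridge_block)
    (dot (col_mx (usubmx z) (a *: egrad psi (dsubmx z)))).
Proof.
move=> zint.
have [_ _ _ [_ psidiff _] _] := psi_legendre.
have psiz := is_diff_grad (psidiff _ ((interior_edom_ridge_block z).1 zint)).
have kz := is_diff_usubmx (is_diff_ridge (usubmx z)).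
have := is_diff_block_sum a_gt0 psi_gtNy zint kz psiz.
by rewrite scale_col_mx scaler0 add_col_mx addr0 add0r.
Qed.

Lemma egrad_ridge_block z : (edom ridge_block)° z ->
  egrad ridge_block z = col_mx (usubmx z) (a *: egrad psi (dsubmx z)).
Proof. by move=> /is_diff_ridge_block /gradE. Qed.

Lemma usubmx_conv z w t : usubmx (t *: z + (1 - t) *: w : 'cV[R]_(d + n)) =
  t *: usubmx z + (1 - t) *: usubmx w.
Proof. by rewrite linearD !linearZ. Qed.

Lemma dsubmx_conv z w t : dsubmx (t *: z + (1 - t) *: w : 'cV[R]_(d + n)) =
  t *: dsubmx z + (1 - t) *: dsubmx w.
Proof. by rewrite linearD !linearZ. Qed.

(** Distinct points differ in y, where psi is strictly convex, or agree in y and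
  differ in x, where the quadratic is strictly convex. *)
Lemma ridge_block_strict : strictly_econvex_on (edom ridge_block)° ridge_block.
Proof.
have [_ _ cpsi _ spsi] := psi_legendre.
move=> z w t /interior_edom_ridge_block zint /interior_edom_ridge_block wint.
move=> zw /[dup] t01 /andP[t0 t1].
have psiz := interior_subset zint; have psiw := interior_subset wint.
have t01' : 0 <= t <= 1 by rewrite !ltW.
have := cpsi _ _ _ psiz psiw t01'.
rewrite (edom_fineK psi_gtNy psiz) (edom_fineK psi_gtNy psiw).
rewrite -!EFinM -EFinD => cvx.
have psit : edom psi (dsubmx (t *: z + (1 - t) *: w)).
  by rewrite /edom/= dsubmx_conv; apply: le_lt_trans cvx _; exact: ltry.
rewrite /ridge_block !block_sum_fin// -!EFinM -EFinD lte_fin usubmx_conv.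
have [yy|yy] := eqVneq (dsubmx z) (dsubmx w).
  have xx : usubmx z != usubmx w.
    by apply/eqP => xx; apply: zw; rewrite -[z]vsubmxK xx yy vsubmxK.
  move: cvx; rewrite -dsubmx_conv (edom_fineK psi_gtNy psit) lee_fin.
  move=> /(ler_wpM2l (ltW a_gt0)).
  rewrite ridge_conv.
  have : 0 < t * (1 - t) * ridge (usubmx z - usubmx w).
    by rewrite mulr_gt0 ?ridge_gt0 ?subr_eq0// mulr_gt0// subr_gt0.
  by rewrite /=; lra.
have := spsi _ _ _ zint wint (elimN eqP yy) t01.
rewrite -dsubmx_conv (edom_fineK psi_gtNy psiz) (edom_fineK psi_gtNy psiw).
rewrite (edom_fineK psi_gtNy psit) -!EFinM -EFinD lte_fin -(ltr_pM2l a_gt0).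
have := ridge_convex (usubmx z) (usubmx w) t01'.
by rewrite /=; lra.
Qed.

(** A boundary point of the domain projects to a boundary point of the domain of
  psi, and the gradient has norm at least a |grad psi(y)|, so it blows up along
  with grad psi. *)
Lemma ridge_block_legendre : legendre ridge_block.
Proof.
have [lpsi [_ [y0 py0]] cpsi [[y1 iy1] dpsi blow] _] := psi_legendre.
split.
- apply: block_sum_lsc => // z.
  have [] := is_diff_usubmx (is_diff_ridge (usubmx z)).
  by move=> /differentiable_continuous.
- split; first exact: block_sum_gtNy.
  by exists (col_mx 0 y0); rewrite /ridge_block edom_block_sum//= col_mxKd.
- apply: block_sum_econvex => // z w t t01.
  by rewrite usubmx_conv; exact: ridge_convex.
- split.
  + by exists (col_mx 0 y1); apply/interior_edom_ridge_block; rewrite col_mxKd.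
  + by move=> z /is_diff_ridge_block [].
  + move=> u z uint [clz zNint] uz.
    have cly : (closure (edom psi) `\` (edom psi)°) (dsubmx z).
      split; last by move=> /interior_edom_ridge_block.
      by apply: closure_dsubmx; move: clz; rewrite /ridge_block edom_block_sum.
    have uy : (fun i => dsubmx (u i)) @ \oo --> dsubmx z.
      exact: continuous_cvg (@dsubmx_continuous _ _ _ z) uz.
    have := blow _ _ (fun i => (interior_edom_ridge_block _).1 (uint i)) cly uy.
    move=> /cvgryPge big; apply/cvgryPge => B.
    have := big (B / a); apply: filterS => i.
    rewrite ler_pdivrMr// mulrC => /le_trans; apply.
    rewrite egrad_ridge_block// -[X in X * _]gtr0_norm// -enormZ ler_enorm.
    by rewrite dot_col_mx lerDr dot_ge0.
- exact: ridge_block_strict.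
Qed.

Lemma bregman_ridge_block z w : (edom ridge_block)° z -> edom ridge_block w ->
  bregman ridge_block w z =
  (ridge (usubmx w - usubmx z) +
   a * (fine (psi (dsubmx w)) - fine (psi (dsubmx z)) -
        dot (egrad psi (dsubmx z)) (dsubmx w - dsubmx z)))%:E.
Proof.
move=> zint; have zdom := interior_subset zint.
rewrite /bregman egrad_ridge_block//.
move: zdom; rewrite {1 2}/ridge_block edom_block_sum//= => psiz psiw.
rewrite /ridge_block !block_sum_fin// -!EFinB; congr (_%:E).
rewrite -[in X in dot _ X](vsubmxK z) -[in X in dot _ X](vsubmxK w).
rewrite opp_col_mx add_col_mx dot_col_mx dotZl -ridgeB; lra.
Qed.

End RidgeBlock.

(** * The primal objective *)

Section Primal.
Context {R : realType} {n d : nat}.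
Variables (phi : 'cV[R]_n -> R) (A : 'M[R]_(n, d)) (lambda beta : R).
Hypothesis phi_convex : convex_function setT phi.
Hypothesis phi_smooth : smooth beta phi.

Lemma is_diff_primal x : is_diff x (primal phi A lambda)
  (dot (A^T *m grad phi (A *m x) + lambda *: x)).
Proof.
apply: is_diff_dotD; last exact/is_diff_dotZ/is_diff_ridge.
exact/is_diff_comp_mulmx/is_diff_grad/phi_smooth.1.
Qed.

(** The gradients at x and y differ by
  A^T (grad phi (A x) - grad phi (A y)) + lambda (x - y); A and its
  transpose each contribute one factor of the spectral norm. *)
Lemma primal_smooth : 0 < lambda -> 0 < beta ->
  smooth (lambda + beta * spectral_norm A ^+ 2) (primal phi A lambda).
Proof.
move=> l0 b0; split=> [x|x y]; first by have [] := is_diff_primal x.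
rewrite !(gradE (is_diff_primal _)).
rewrite opprD addrACA -mulmxBr -scalerBr.
apply: le_trans (enormD _ _) _; rewrite mulrDl addrC enormZ gtr0_norm// lerD2l.
have S0 := spectral_norm_ge0 A.
apply: le_trans (enorm_trmulmx _ _) _.
rewrite expr2 !mulrA [beta * _]mulrC -!mulrA ler_wpM2l//.
apply: le_trans (phi_smooth.2 _ _) _.
by rewrite ler_pM2l// -mulmxBr enorm_mulmx.
Qed.

Lemma primal_strongly_convex : strongly_convex lambda (primal phi A lambda).
Proof.
apply/convex_functionP => x y t t01.
have E z : primal phi A lambda z - lambda / 2 * enorm z ^+ 2 = phi (A *m z).
  by rewrite /primal /ridge mulrA addrK.
rewrite !E mulmxDr -!scalemxAr.
by have /convex_functionP := phi_convex; apply.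
Qed.

Lemma primal_ge x w :
  primal phi A lambda x +
    dot (A^T *m grad phi (A *m x) + lambda *: x) (w - x) +
    lambda * ridge (w - x) <= primal phi A lambda w.
Proof.
have := convex_grad_le (A *m w) phi_convex (phi_smooth.1 (A *m x)).
by rewrite -mulmxBr dot_mulmx /primal -ridgeB dotDl dotZl; lra.
Qed.

End Primal.

(** * The lifted objective *)

Section Lifted.
Context {R : realType} {n d : nat}.
Variables (phi : 'cV[R]_n -> R) (A : 'M[R]_(n, d)) (lambda beta : R).
Hypothesis phi_convex : convex_function setT phi.
Hypothesis lambda_gt0 : 0 < lambda.
Hypothesis beta_gt0 : 0 < beta.
Hypothesis phi_smooth : smooth beta phi.
Hypothesis phi_conj_legendre : legendre (phi_conj phi).

Local Notation psi := (phi_conj phi).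
Local Notation f := (primal phi A lambda).
Local Notation B := (- lambda^-1 *: A^T).

Lemma referenceE : reference phi lambda = ridge_block (d := d) lambda^-1 psi.
Proof. by []. Qed.

(** The everywhere finite part of the lifted objective.  Its quadratic part in y
  equals the conjugate of the ridge term, by [conjugate_ridge]. *)
Definition lifted_coupling (z : 'cV[R]_(d + n)) : R :=
  f (usubmx z) + lambda * ridge (B *m dsubmx z).

Lemma liftedE : lifted phi A lambda = block_sum lifted_coupling 1 psi.
Proof.
apply/funext => z; rewrite /lifted /dual /block_sum conjugate_ridge mul1e.
by rewrite scalemxAl addeCA -EFinM -EFinD addeC.
Qed.

Let psi_gtNy : forall y, (-oo < psi y)%E.
Proof. by have [_ []] := phi_conj_legendre. Qed.

Lemma edom_lifted : edom (lifted phi A lambda) = lifted_domain phi.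
Proof. by rewrite liftedE edom_block_sum. Qed.

Lemma edom_reference : edom (reference phi lambda) = lifted_domain (d := d) phi.
Proof. by rewrite referenceE /ridge_block edom_block_sum// invr_gt0. Qed.

Lemma lifted_econvex : econvex (lifted phi A lambda).
Proof.
rewrite liftedE; apply: block_sum_econvex => //; last first.
  by case: phi_conj_legendre.
move=> z w t t01; rewrite /lifted_coupling usubmx_conv dsubmx_conv.
rewrite mulmxDr -!scalemxAr.
have /convex_functionP/(_ (A *m usubmx z) (A *m usubmx w) t t01) := phi_convex.
have := ridge_convex (B *m dsubmx z) (B *m dsubmx w) t01.
have := ridge_convex (usubmx z) (usubmx w) t01.
move=> /(ler_wpM2l (ltW lambda_gt0)) + /(ler_wpM2l (ltW lambda_gt0)).
by rewrite /primal mulmxDr -!scalemxAr; lra.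
Qed.

Definition lifted_grad (z : 'cV[R]_(d + n)) : 'cV[R]_(d + n) :=
  col_mx (A^T *m grad phi (A *m usubmx z) + lambda *: usubmx z)
         (lambda *: (B^T *m (B *m dsubmx z)) + egrad psi (dsubmx z)).

Lemma is_diff_lifted z : (edom (lifted phi A lambda))° z ->
  is_diff z (fine \o lifted phi A lambda) (dot (lifted_grad z)).
Proof.
rewrite liftedE => zint.
have psiz : is_diff (dsubmx z) (fine \o psi) (dot (egrad psi (dsubmx z))).
  have [_ _ _ [_ psidiff _] _] := phi_conj_legendre.
  apply/is_diff_grad/psidiff.
  by move: zint; rewrite edom_block_sum// interior_dsubmx.
have := is_diff_block_sum ltr01 psi_gtNy zint _ psiz.
move=> /(_ (col_mx (A^T *m grad phi (A *m usubmx z) + lambda *: usubmx z)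
         (lambda *: (B^T *m (B *m dsubmx z))))).
rewrite scale1r add_col_mx addr0; apply.
rewrite -[X in col_mx X]addr0 -[X in col_mx _ X]add0r -add_col_mx.
have fz := is_diff_usubmx (is_diff_primal A lambda phi_smooth (usubmx z)).
have Bz := is_diff_dsubmx
  (is_diff_dotZ lambda (is_diff_comp_mulmx (is_diff_ridge (B *m dsubmx z)))).
exact: is_diff_dotD fz Bz.
Qed.

Lemma lifted_subgradientE G z : (edom (lifted phi A lambda))° z ->
  subdiff (lifted phi A lambda) z G -> G = lifted_grad z.
Proof.
move=> zint Gz; apply: subgradient_grad (is_diff_lifted zint) _.
have zdom := interior_subset zint.
move: zint zdom; rewrite liftedE edom_block_sum// => zint zdom.
move: zint; apply: filterS => w psiw.
by have := Gz w; rewrite liftedE /= !block_sum_fin// -EFinD lee_fin.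
Qed.

Lemma lifted_subgradient z : (edom (lifted phi A lambda))° z ->
  subdiff (lifted phi A lambda) z (lifted_grad z).
Proof.
move=> zint; apply: grad_subdiff (is_diff_lifted zint).
- by rewrite liftedE; exact: block_sum_gtNy.
- exact: lifted_econvex.
- exact: interior_subset zint.
Qed.

Definition conj_bregman (w y : 'cV[R]_n) : R :=
  fine (psi w) - fine (psi y) - dot (egrad psi y) (w - y).

Lemma conj_bregman_ge y w : (edom psi)° y -> edom psi w ->
  ridge (w - y) <= beta * conj_bregman w y.
Proof.
move=> yint wdom; have ydom := interior_subset yint.
have [_ _ cpsi [_ psidiff _] _] := phi_conj_legendre.
have y_sub : subdiff psi y (egrad psi y).
  exact: grad_subdiff (is_diff_grad (psidiff _ yint)).
have := conjugate_strongly_convex w phi_convex beta_gt0 phi_smooth y_sub.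
rewrite -/psi (edom_fineK psi_gtNy ydom) (edom_fineK psi_gtNy wdom).
rewrite -EFinD lee_fin /= => psi_ge.
by rewrite -ler_pdivrMl// /conj_bregman; lra.
Qed.

(** The left-hand side equals r(A^T v) / lambda. *)
Lemma ridge_dual_le v :
  lambda * ridge (B *m v) <= spectral_norm A ^+ 2 * (lambda^-1 * ridge v).
Proof.
have S0 := spectral_norm_ge0 A.
rewrite -scalemxAl /ridge enormZ normrN gtr0_norm ?invr_gt0// exprMn.
have -> : lambda * (2^-1 * (lambda^-1 ^+ 2 * enorm (A^T *m v) ^+ 2)) =
    lambda^-1 * 2^-1 * enorm (A^T *m v) ^+ 2 by field; rewrite gt_eqF.
have -> : spectral_norm A ^+ 2 * (lambda^-1 * (2^-1 * enorm v ^+ 2)) =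
    lambda^-1 * 2^-1 * (spectral_norm A * enorm v) ^+ 2 by ring.
rewrite ler_pM2l ?mulr_gt0 ?invr_gt0//.
by rewrite ler_pXn2r ?nnegrE ?mulr_ge0 ?enorm_ge0// enorm_trmulmx.
Qed.

(** Both remainders are compared block by block.  In y, the remainder of F is
  D_psi(y', y) + lambda r(B (y' - y)) with B = - A^T / lambda; its last term is
  between 0 and (beta |A|^2 / lambda) D_psi(y', y), and L / lambda is
  1 + beta |A|^2 / lambda. *)
Lemma lifted_relative z w : (edom (reference phi lambda))° z ->
  edom (reference phi lambda) w ->
  let F := lifted phi A lambda in
  let h := reference phi lambda in
  let L := lambda + beta * spectral_norm A ^+ 2 in
  (F w <= F z + (dot (lifted_grad z) (w - z))%:E + L%:E * bregman h w z)%E /\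
  (F z + (dot (lifted_grad z) (w - z))%:E + lambda%:E * bregman h w z <= F w)%E.
Proof.
move=> zint wdom F h L.
have l0' : 0 < lambda^-1 by rewrite invr_gt0.
rewrite /h referenceE (bregman_ridge_block l0' phi_conj_legendre)// /F.
move: zint wdom; rewrite edom_reference /lifted_domain => zint wdom.
have zdom : edom psi (dsubmx z) := interior_subset zint.
have yint : (edom psi)° (dsubmx z) by move: zint; rewrite interior_dsubmx.
rewrite liftedE !block_sum_fin// -!EFinM -!EFinD !lee_fin !mul1r.
rewrite /lifted_coupling dot_blocks /lifted_grad col_mxKu col_mxKd.
rewrite [dot (_ + egrad _ _) _]dotDl [dot (lambda *: (B^T *m _)) _]dotZl.
rewrite ![usubmx (w - z)]linearB ![dsubmx (w - z)]linearB /=.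
have f_ub := smooth_ub (usubmx z) (usubmx w)
  (primal_smooth A phi_smooth lambda_gt0 beta_gt0).
have f_lb := primal_ge A lambda phi_convex phi_smooth (usubmx z) (usubmx w).
have quad := ridgeB (B *m dsubmx z) (B *m dsubmx w).
rewrite -/L (gradE (is_diff_primal A lambda phi_smooth _)) in f_ub.
rewrite -sqr_enorm -mulrA -/(ridge _) in f_ub.
rewrite -mulmxBr dot_mulmx in quad.
have psi_ge := conj_bregman_ge yint wdom.
have quad_ub := ridge_dual_le (dsubmx w - dsubmx z).
have quad_ge0 := ridge_ge0 (B *m (dsubmx w - dsubmx z)).
rewrite -/(conj_bregman (dsubmx w) (dsubmx z)).
have psiE : fine (psi (dsubmx w)) = fine (psi (dsubmx z)) +
    dot (egrad psi (dsubmx z)) (dsubmx w - dsubmx z) +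
    conj_bregman (dsubmx w) (dsubmx z).
  by rewrite /conj_bregman; lra.
have quadE : lambda * ridge (B *m dsubmx w) = lambda * (ridge (B *m dsubmx z) +
    dot (B^T *m (B *m dsubmx z)) (dsubmx w - dsubmx z)) +
    lambda * ridge (B *m (dsubmx w - dsubmx z)).
  by rewrite -quad; lra.
have quad_le : lambda * ridge (B *m (dsubmx w - dsubmx z)) <=
    beta * spectral_norm A ^+ 2 *
    (lambda^-1 * conj_bregman (dsubmx w) (dsubmx z)).
  apply: le_trans quad_ub _.
  rewrite [leRHS](_ : _ = spectral_norm A ^+ 2 *
    (lambda^-1 * (beta * conj_bregman (dsubmx w) (dsubmx z)))); last by ring.
  by rewrite ler_wpM2l ?sqr_ge0// ler_pM2l.
have lquad_ge0 := mulr_ge0 (ltW lambda_gt0) quad_ge0.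
have lpsi : lambda * (lambda^-1 * conj_bregman (dsubmx w) (dsubmx z)) =
    conj_bregman (dsubmx w) (dsubmx z) by rewrite mulVKf// gt_eqF.
rewrite psiE quadE; rewrite /L in f_ub *.
clear -f_lb f_ub quad_le lquad_ge0 lpsi.
by split; lra.
Qed.

End Lifted.

Unset Implicit Arguments.

Theorem proposition12 (R : realType) (n d : nat)
    (phi : 'cV[R]_n -> R) (A : 'M[R]_(n, d)) (lambda beta : R)
    (phi_convex : convex_function setT phi)
    (phi_closed : lower_semicontinuous (EFin \o phi))
    (lambda_gt0 : 0 < lambda) (beta_gt0 : 0 < beta)
    (phi_smooth : smooth beta phi)
    (phi_conj_legendre : legendre (phi_conj phi)) :
  let L := lambda + beta * spectral_norm A ^+ 2 in
  let f := primal phi A lambda in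
  let F := lifted phi A lambda in
  let h := reference phi lambda in
  let Z := lifted_domain phi in
  [/\ smooth L f /\ strongly_convex lambda f,
      legendre h /\ edom h = Z,
      real_valued_exactly_on Z F /\ econvex F,
      exists G, subgradient_selection F G &
      forall G, subgradient_selection F G ->
        relatively_smooth L F G h /\ relatively_strongly_convex lambda F G h].
Proof.
move=> L f F h Z.
have edom_F : edom F = Z := edom_lifted A lambda phi_conj_legendre.
have edom_h : edom h = Z := edom_reference lambda_gt0 phi_conj_legendre.
split.
- by split; [exact: primal_smooth|exact: primal_strongly_convex].
- split=> //; rewrite /h referenceE.
  by apply: ridge_block_legendre; rewrite ?invr_gt0.
- split; last exact: lifted_econvex.
  split=> // z; rewrite /F liftedE; apply: block_sum_gtNy => //.
  by have [_ []] := phi_conj_legendre.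
- exists (lifted_grad phi A lambda) => z.
  exact: (lifted_subgradient phi_convex lambda_gt0 phi_smooth).
- move=> G Gsub; have gradG z : (edom h)° z -> G z = lifted_grad phi A lambda z.
    rewrite edom_h -edom_F => zint.
    exact: (lifted_subgradientE phi_smooth) (Gsub z zint).
  split=> z w zint wdom; rewrite gradG//.
  all: have [ub lb] := lifted_relative A phi_convex lambda_gt0 beta_gt0
    phi_smooth phi_conj_legendre zint wdom.
  + exact: ub.
  + exact: lb.
Qed.
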